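(* Let $(\mathcal{A},\tau)$ be a tracial non-commutative probability space with unit ${\bf 1}$, let $P,Q\in\mathcal{A}$ be two orthogonal projections, and let $B:={\bf 1}-(P+Q)$. Then for every integer $j\ge1$, $$\tau[B^{2j}({\bf 1}-B^2)^j]=2\tau[(B^2P({\bf 1}-B^2)P)^j]=2\tau[B^{2j}({\bf 1}-B^2)^jP],$$ or equivalently $$\tau[B^{2j}({\bf 1}-B^2)^jP]=\tau[B^{2j}({\bf 1}-B^2)^j({\bf 1}-P)].$$
   Context: A tracial non-commutative probability space $(\mathcal{A},\tau)$ is a unital $*$-algebra $\mathcal{A}$ with unit ${\bf 1}$ together with a state $\tau$ ($\tau({\bf 1})=1$) satisfying $\tau(xy)=\tau(yx)$. An orthogonal projection is an element $P$ with $P=P^\star=P^2$. No freeness or general position assumption is made on $P,Q$. *)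

(* Defs.v *)
From HB Require Import structures.
From mathcomp Require Import all_boot all_order all_algebra.
From mathcomp Require Import complex.
From mathcomp Require Import reals.

Set Implicit Arguments.
Unset Strict Implicit.
Unset Printing Implicit Defensive.

Import Order.TTheory GRing.Theory Num.Theory.
Local Open Scope ring_scope.

(* Unital complex *-algebras: the scalars are R[i] with R the real numbers,
   and the involution is conjugate-linear and reverses products. *)
HB.mixin Record Algebra_isStarAlgebra (R : realType) A
    of GRing.Algebra R[i] A := {
  star : A -> A;
  starK : involutive star;
  starD : {morph star : x y / x + y};
  starZ : forall (a : R[i]) (x : A), star (a *: x) = Num.conj a *: star x;
  starM : forall x y : A, star (x * y) = star y * star x
}.

#[short(type="starAlgType")]
HB.structure Definition StarAlgebra (R : realType) :=
  {A of Algebra_isStarAlgebra R A & GRing.Algebra R[i] A}.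

Section NCProbability.
Variables (R : realType) (A : starAlgType R).

Definition is_projection (P : A) : Prop := star P = P /\ P * P = P.

(* In the order of R[i], 0 <= z means that z is real and nonnegative, so
   positivity includes the reality of tau (star x * x). *)
Definition is_state (tau : {scalar A}) : Prop :=
  (forall x : A, 0 <= tau (star x * x)) /\ tau 1 = 1.

Definition is_tracial (tau : {scalar A}) : Prop :=
  forall x y : A, tau (x * y) = tau (y * x).

End NCProbability.

(* Main.v *)
Require Import Defs.
From HB Require Import structures.
From mathcomp Require Import all_boot all_order all_algebra.
From mathcomp Require Import complex.
From mathcomp Require Import reals.

Set Implicit Arguments.
Unset Strict Implicit.
Unset Printing Implicit Defensive.

Import Order.TTheory GRing.Theory Num.Theory.
Local Open Scope ring_scope.

(** Put B = 1 - (P + Q) and C = P - Q.  Then B ^+ 2 + C ^+ 2 = 1, and both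
    elements intertwine the projections: P B = B Q while P C = C (1 - Q)
    (lemmas [sqr_sumC_sqr_diff], [sumC_intertwines] and [diff_intertwines]).
    Under a trace, if P U = U P', then P and P' have the same weight against
    U ^+ 2 D for every D commuting with U ([trace_intertwiner]).

    The weight W = B ^+ (2 j) (1 - B ^+ 2) ^+ j contains both factors B ^+ 2
    and C ^+ 2 because j >= 1, so that
      tau (W P) = tau (W Q)  and  tau (W P) = tau (W (1 - Q)).
    Adding the two gives tau W = 2 tau (W P), hence also
    tau (W P) = tau (W (1 - P)).  Finally B ^+ 2 commutes with P, so the
    word (B ^+ 2 P (1 - B ^+ 2) P) ^+ j collapses to W P, and the three
    quantities agree. *)

(** Only one factor U has to be carried through P: moving it around the trace
    and through D brings the two copies of U together again. *)
Lemma trace_intertwiner (A : pzRingType) (V : Type) (tau : A -> V)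
    (tauC : forall x y : A, tau (x * y) = tau (y * x)) (U D P P' : A) :
  P * U = U * P' -> GRing.comm U D ->
  tau (U ^+ 2 * D * P) = tau (U ^+ 2 * D * P').
Proof.
move=> PU UD; rewrite expr2 -[in LHS]mulrA tauC.
by rewrite -(mulrA U) UD -!mulrA -PU [RHS]tauC !mulrA.
Qed.

Section Idempotents.
Variables (A : pzRingType) (P Q : A).
Hypotheses (PP : P * P = P) (QQ : Q * Q = Q).

Lemma sumC_intertwines : P * (1 - (P + Q)) = (1 - (P + Q)) * Q.
Proof.
rewrite mulrBr mulrBl mulr1 mul1r mulrDr mulrDl PP QQ.
by rewrite !opprD addrA subrr addrCA subrr addr0 add0r.
Qed.

Lemma diff_intertwines : P * (P - Q) = (P - Q) * (1 - Q).
Proof. by rewrite mulrBr PP mulrBr mulr1 mulrBl QQ opprB addrA subrK. Qed.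

(** The parallelogram identity (P + Q) ^+ 2 + (P - Q) ^+ 2 = 2 (P + Q) holds
    for idempotents: the mixed products cancel. *)
Lemma sqr_sumC_sqr_diff : (1 - (P + Q)) ^+ 2 + (P - Q) ^+ 2 = 1.
Proof.
have sum_diff (a b : A) : (a + b) + (a - b) = a + a.
  by rewrite addrACA subrr addr0.
have SC : (P + Q) ^+ 2 + (P - Q) ^+ 2 = (P + Q) + (P + Q).
  rewrite !expr2 mulrDl mulrBl !mulrDr !mulrN PP QQ addrACA sum_diff.
  by rewrite opprB (addrC (Q * P)) sum_diff addrACA.
rewrite expr2 mulrBr mulr1 mulrBl mul1r -expr2 opprB.
by rewrite -addrA (addrAC (_ ^+ 2)) SC addrK subrK.
Qed.

End Idempotents.

Section TracedIdempotents.
Variables (A : pzRingType) (V : zmodType) (tau : {additive A -> V}).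
Hypothesis tauC : forall x y : A, tau (x * y) = tau (y * x).
Variables (P Q : A).
Hypotheses (PP : P * P = P) (QQ : Q * Q = Q).

Let B := 1 - (P + Q).
Let C := P - Q.

Let sqrC : 1 - B ^+ 2 = C ^+ 2.
Proof. by rewrite -(sqr_sumC_sqr_diff PP QQ) addrC addKr. Qed.

Let W k := B ^+ (2 * k) * (1 - B ^+ 2) ^+ k.

(** P B = B Q and Q B = B P, so carrying P through B twice brings P back. *)
Lemma comm_idempotent_sqr_sumC : GRing.comm P (B ^+ 2).
Proof.
have QB : Q * B = B * P by rewrite /B (addrC P); exact: sumC_intertwines.
have PB : P * B = B * Q by exact: sumC_intertwines.
by rewrite /GRing.comm expr2 mulrA PB -mulrA QB mulrA.
Qed.

(** The positive exponent leaves a factor B ^+ 2 to split off; the remaining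
    factors are polynomials in B, hence commute with B. *)
Lemma trace_weight_swap k : tau (W k.+1 * P) = tau (W k.+1 * Q).
Proof.
rewrite /W mulnS exprD -(mulrA _ (B ^+ (2 * k))).
apply: trace_intertwiner => //; first exact: sumC_intertwines.
by do ![exact: commr_refl | apply: commrX | apply: commrM | apply: commrB | exact: commr1].
Qed.

(** The weight is equally (1 - C ^+ 2) ^+ k C ^+ (2 k), so the argument of
    [trace_weight_swap] applies with C as the intertwiner. *)
Lemma trace_weight_swap_compl k : tau (W k.+1 * P) = tau (W k.+1 * (1 - Q)).
Proof.
have sqrB : B ^+ 2 = 1 - C ^+ 2 by rewrite -sqrC subKr.
rewrite /W exprM sqrC sqrB.
have cCC : GRing.comm (C ^+ 2) ((1 - C ^+ 2) ^+ k.+1).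
  by apply/commrX/commrB; [exact: commr1 | exact: commr_refl].
rewrite (exprS (C ^+ 2)) (mulrA (_ ^+ k.+1)) -cCC -(mulrA _ (_ ^+ k.+1)).
apply: trace_intertwiner => //; first exact: diff_intertwines.
by do ![exact: commr_refl | apply: commrX | apply: commrM | apply: commrB | exact: commr1].
Qed.

(** The weights of Q and 1 - Q add up to the full weight, and each of them
    equals the weight of P. *)
Lemma trace_weight k : tau (W k.+1) = tau (W k.+1 * P) *+ 2.
Proof.
rewrite mulr2n {1}trace_weight_swap trace_weight_swap_compl -raddfD -mulrDr.
by rewrite addrC subrK mulr1.
Qed.

Lemma compressed_word_exp k :
  (B ^+ 2 * P * (1 - B ^+ 2) * P) ^+ k.+1 = W k.+1 * P.
Proof.
have cPX := comm_idempotent_sqr_sumC.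
have cPY : GRing.comm P (1 - B ^+ 2) by apply: commrB => //; exact: commr1.
rewrite -(mulrA (B ^+ 2)) cPY mulrA -mulrA PP.
rewrite exprMn_comm; last by apply: commr_sym; apply: commrM.
rewrite exprMn_comm; last by apply: commrB; [exact: commr1 | ].
rewrite /W exprM; congr (_ * _).
by elim: k => [|k IHk]; rewrite ?expr1 // exprS IHk.
Qed.

End TracedIdempotents.

Theorem mainTheorem6 (R : realType) (A : starAlgType R) (tau : {scalar A})
    (tau_state : is_state tau) (tau_tracial : is_tracial tau)
    (P Q : A) (P_proj : is_projection P) (Q_proj : is_projection Q)
    (j : nat) (j_ge1 : (1 <= j)%N) :
  let B : A := 1 - (P + Q) in
  [/\ tau (B ^+ (2 * j) * (1 - B ^+ 2) ^+ j)
        = 2 * tau ((B ^+ 2 * P * (1 - B ^+ 2) * P) ^+ j),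
      2 * tau ((B ^+ 2 * P * (1 - B ^+ 2) * P) ^+ j)
        = 2 * tau (B ^+ (2 * j) * (1 - B ^+ 2) ^+ j * P)
    & tau (B ^+ (2 * j) * (1 - B ^+ 2) ^+ j * P)
        = tau (B ^+ (2 * j) * (1 - B ^+ 2) ^+ j * (1 - P))].
Proof.
move=> B; case: P_proj => _ PP; case: Q_proj => _ QQ.
case: j j_ge1 => // k _.
have tauW := trace_weight tau_tracial PP QQ k.
rewrite compressed_word_exp // tauW; split; rewrite ?mulr_natl //.
by rewrite mulrBr mulr1 raddfB /= tauW mulr2n addrK.
Qed.
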